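(* Let $w,\mathrm{dim},d$ be positive integers and let the dataset be the full integer grid $S=X=\{(a_1,\dots,a_{\mathrm{dim}}) : a_i\in\mathbb{N},\ a_i\le w \text{ for all } i\}$, with $n=|S|$ points. Let $H$ be the class of binary decision trees of height at most $d$ on $X$ in which every internal node tests a feature dimension distinct from those tested by all of its ancestors. Then the disagreement coefficient $\theta$ of $H$ on $S$ satisfies $\theta=O(\ln^{d}(n))$ and $\theta=\Omega\big(c\,(\ln(n)-c')^{d-1}\big)$, where $c=\frac{2^{-\mathrm{dim}}}{d^{d-1}\,d!}$ and $c'=\ln(4)\,\mathrm{dim}$.
   Context: A decision tree classifies a point $x$ by routing it from the root: each internal node compares one coordinate $x_a$ with a threshold $t$ (going to one child if $x_a\ge t$ and to the other otherwise) and each leaf carries a label in $\{0,1\}$. For a finite dataset $S$ of $n$ points and $h,h'\in H$, $D_S(h,h')=\frac1n\sum_{x\in S}\mathbb{I}(h(x)\ne h'(x))$; the ball is $B_H(h,r)=\{h'\in H: D_S(h,h')\le r\}$; for $V\subseteq H$ the disagreement region is $\mathrm{DIS}_S(V)=\{x\in S:\exists h_1,h_2\in V,\ h_1(x)\neq h_2(x)\}$. The disagreement coefficient of $h$ is $\theta_h=\sup_{r>0}\frac{|\mathrm{DIS}_S(B_H(h,r))|}{rn}$ and that of $H$ is $\theta=\sup_{h\in H}\theta_h$.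
   Formalization: The lower bound is stated only for d ≤ dim; for d > dim it is false (for dim = 1, d = 2 the class is one-dimensional thresholds, whose disagreement coefficient is bounded while the claimed bound grows like ln n). *)

(* Defs.v *)
From HB Require Import structures.
From mathcomp Require Import all_boot all_order all_algebra.
From mathcomp Require Import all_classical all_reals all_analysis.
Set Implicit Arguments. Unset Strict Implicit. Unset Printing Implicit Defensive.
Import Order.TTheory GRing.Theory Num.Theory.
Local Open Scope classical_set_scope.
Local Open Scope ring_scope.

Definition gpoint (dim w : nat) : finType := {ffun 'I_dim -> 'I_w.+1}.

(* Binary decision trees on points of dimension dim:
   DNode a t Tge Tlt tests x_a >= t, going to Tge if so and to Tlt otherwise.
   Thresholds are naturals (on the integer grid every real threshold
   induces the same test as some natural threshold). *)
Inductive dtree (dim : nat) : Type :=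
  | DLeaf of bool
  | DNode of 'I_dim & nat & dtree dim & dtree dim.

Fixpoint dt_eval (dim w : nat) (T : dtree dim) (x : gpoint dim w) : bool :=
  match T with
  | DLeaf b => b
  | DNode a t Tge Tlt =>
      if (t <= nat_of_ord (x a))%N then dt_eval Tge x else dt_eval Tlt x
  end.

Fixpoint dt_height (dim : nat) (T : dtree dim) : nat :=
  match T with
  | DLeaf _ => 0%N
  | DNode _ _ Tge Tlt => (maxn (dt_height Tge) (dt_height Tlt)).+1
  end.

Fixpoint dt_distinct (dim : nat) (anc : seq 'I_dim) (T : dtree dim) : bool :=
  match T with
  | DLeaf _ => true
  | DNode a _ Tge Tlt =>
      (a \notin anc) && dt_distinct (a :: anc) Tge && dt_distinct (a :: anc) Tlt
  end.

Definition Hclass (dim w d : nat) : set (gpoint dim w -> bool) :=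
  [set h | exists T : dtree dim,
       (dt_height T <= d)%N /\ dt_distinct [::] T /\ forall x, h x = dt_eval T x].

Section Disagreement.
Variables (R : realType) (dim w d : nat).

Definition npts : nat := #|gpoint dim w|.

Definition DS (h h' : gpoint dim w -> bool) : R :=
  (#|[set x : gpoint dim w | h x != h' x]|%:R) / (npts%:R).

Definition ballH (h : gpoint dim w -> bool) (r : R) : set (gpoint dim w -> bool) :=
  [set h' | @Hclass dim w d h' /\ DS h h' <= r].

Definition DIS (V : set (gpoint dim w -> bool)) : {set gpoint dim w} :=
  [set x : gpoint dim w |
     `[< exists h1 h2, V h1 /\ V h2 /\ h1 x != h2 x >]].

Definition theta_h (h : gpoint dim w -> bool) : R :=
  sup [set (#|DIS (ballH h r)|%:R / (r * npts%:R)) | r in [set r : R | 0 < r]].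

Definition theta : R := sup [set theta_h h | h in @Hclass dim w d].

End Disagreement.

(* Main.v *)
(* Upper bound. A root-to-leaf path tests pairwise distinct coordinates, so a
   tree of height d is constant on a box having a corner at x that constrains
   at most d coordinates, each on one side only. If h' differs from h at x and
   is r-close to h, then such a box, cut by the leaf cell of h containing x, has
   at most r n points. Inside a cell, by Markov's inequality the number of such
   x is at most r n times the sum over x of the inverse box sizes. That sum
   factorises over the coordinates into at most d harmonic sums, and h has at
   most 2^d cells.

   Lower bound. Take h = 0, m = w + 1 and r = m / m^d. Every x such that
   (x_1 + 1)...(x_d + 1) <= m lies in a corner box {y | y_i <= x_i, i <= d} with
   at most r n points, whose indicator is a tree. The number of such x is
   at least n m ln(m)^(d-1) / (2 m^d (d-1)!), by induction on d. The constant c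
   absorbs the factor dim^(d-1) since (dim/d)^d <= 'C(dim, d) <= 2^dim. *)

Require Import Defs.
From HB Require Import structures.
From mathcomp Require Import all_boot all_order all_algebra.
From mathcomp Require Import all_classical all_reals all_analysis.
From mathcomp Require Import ring lra.
Import Order.TTheory GRing.Theory Num.Theory.
Local Open Scope ring_scope.
Set Implicit Arguments. Unset Strict Implicit. Unset Printing Implicit Defensive.

(** * Harmonic sums and the logarithm *)

Definition harmonic_sum (R : realType) (m : nat) : R := \sum_(i < m) i.+1%:R^-1.

Lemma harmonic_sum_ge0 (R : realType) m : 0 <= harmonic_sum R m.
Proof. by apply: sumr_ge0 => i _; rewrite invr_ge0 ler0n. Qed.

Lemma harmonic_sum_ge1 (R : realType) m : 1 <= harmonic_sum R m.+1.
Proof.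
rewrite /harmonic_sum big_ord_recl invr1 lerDl.
by apply: sumr_ge0 => i _; rewrite invr_ge0 ler0n.
Qed.

(** The tangent line of the concave logarithm at [a]. [harmonic_sum_le_ln] takes [b < a],
    [sum_ln_ge] takes [a < b]. *)
Lemma lnB_le (R : realType) (a b : R) : 0 < a -> 0 < b -> ln b - ln a <= (b - a) / a.
Proof.
move=> a0 b0; rewrite -ln_div ?posrE //.
have -> : b / a = 1 + (b - a) / a by field; rewrite gt_eqF.
by apply: le_ln1Dx; rewrite mulrBl divff ?gt_eqF// ltrBrDr addNr divr_gt0.
Qed.

Lemma harmonic_sum_le_ln (R : realType) m : harmonic_sum R m.+1 <= 1 + ln (m.+1%:R : R).
Proof.
elim: m => [|m IH]; first by rewrite /harmonic_sum big_ord1 invr1 ln1 addr0.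
rewrite /harmonic_sum big_ord_recr /=.
apply: (le_trans (lerD IH (lexx _))).
have := @lnB_le R m.+2%:R m.+1%:R (ltr0Sn _ _) (ltr0Sn _ _).
have -> : (m.+1%:R - m.+2%:R) / m.+2%:R = - (m.+2%:R)^-1 :> R.
  by rewrite -[m.+2%:R]natr1 opprD addrA subrr sub0r mulN1r.
by move=> h; rewrite -addrA lerD2l -lerBrDl -[leRHS]opprB lerNr.
Qed.

(** * Inverse sizes of one-sided intervals *)

Definition side (o : option bool) (x y : nat) : bool :=
  match o with
  | None => true
  | Some true => (x <= y)%N
  | Some false => (y <= x)%N
  end.

Lemma side_refl o x : side o x x.
Proof. by case: o => [[]|] /=. Qed.

(** Along the direction [b], the elements of [I] have pairwise distinct ranks between 1 and [m], so
    the sum consists of distinct terms of the harmonic sum. *)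
Lemma sum_inv_card_side (R : realType) m (I : {set 'I_m}) (b : bool) :
  \sum_(j in I) (#|[pred k in I | side (Some b) j k]|%:R : R)^-1 <= harmonic_sum R m.
Proof.
pose rk (j : 'I_m) := #|[pred k in I | side (Some b) j k]|.
have rk_gt0 j : j \in I -> (0 < rk j)%N.
  by move=> jI; apply/card_gt0P; exists j; rewrite !inE jI side_refl.
have rk_le j : (rk j <= m)%N by rewrite -[leqRHS]card_ord max_card.
have rk_lt j : j \in I -> ((rk j).-1 < m)%N.
  by move=> /rk_gt0 h; rewrite prednK.
have rk_inj (i j : 'I_m) : i \in I -> j \in I -> i != j -> side (Some b) i j ->
    (rk j < rk i)%N.
  move=> iI jI ij sij; apply: proper_card; apply/properP; split.
    apply/fintype.subsetP => k; rewrite !inE => /andP[-> /=].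
    by case: b sij {rk rk_gt0 rk_le rk_lt} => /= h1 h2; [exact: leq_trans h1 h2|exact: leq_trans h2 h1].
  exists i; rewrite !inE ?iI ?side_refl //=.
  apply/negP => sji; case/negP: ij; apply/eqP/val_inj/eqP.
  by rewrite eqn_leq; case: b sij sji {rk rk_gt0 rk_le rk_lt} => /= -> ->.
(* Ranks start at 1, so the predecessor indexes the harmonic sum; by [rk_lt] the default of [insubd]
   never occurs on [I]. *)
have inj : {in I &, injective (fun j => insubd j (rk j).-1)}.
  move=> i j iI jI /(congr1 val); rewrite !val_insubd !rk_lt// => e.
  apply/eqP; apply: contraT => ij.
  have {}e : rk i = rk j by rewrite -(prednK (rk_gt0 i iI)) e prednK// rk_gt0.
  have [s|s] := boolP (side (Some b) i j).
    by have := rk_inj _ _ iI jI ij s; rewrite e ltnn.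
  have s' : side (Some b) j i.
    by case: b s {rk rk_gt0 rk_le rk_lt rk_inj e} => /= ; rewrite -ltnNge => /ltnW.
  by rewrite eq_sym in ij; have := rk_inj _ _ jI iI ij s'; rewrite e ltnn.
rewrite /harmonic_sum.
rewrite (eq_bigr (fun j => ((insubd j (rk j).-1 : 'I_m).+1%:R : R)^-1)); last first.
  by move=> j jI; rewrite val_insubd rk_lt// prednK ?rk_gt0.
rewrite -(big_imset (fun i : 'I_m => (i.+1%:R : R)^-1) inj)/=.
rewrite [leRHS](bigID (mem [set insubd j (rk j).-1 | j in I]%SET)) /= lerDl.
by apply: sumr_ge0 => i _; rewrite invr_ge0 ler0n.
Qed.

(** * Boxes on which a tree is constant, and crowded points *)

Section Upper.
Variables (R : realType) (dim w : nat).
Notation point := (gpoint dim w).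
Notation sides := {ffun 'I_dim -> option bool}.

Definition anchored (s : sides) (x y : point) : bool :=
  [forall i, side (s i) (x i) (y i)].

Definition ntests (s : sides) : nat := #|[pred i | isSome (s i)]|.

(** On the path of [x], pushing a tested coordinate away from its threshold keeps the outcome. The
    clause on [anc] leaves the coordinates of ancestors free, so each new test adds one side without
    clashing with an older one. *)
Lemma dt_eval_anchored anc (T : dtree dim) (x : point) : dt_distinct anc T ->
  exists s : sides, [/\ forall i, i \in anc -> s i = None,
    (ntests s <= dt_height T)%N &
    forall y, anchored s x y -> dt_eval T y = dt_eval T x].
Proof.
elim: T anc => [b|a t T1 IH1 T2 IH2] anc /=.
  move=> _; exists [ffun=> None]; split=> // [i _|]; first by rewrite ffunE.
  by rewrite leqn0; apply/eqP/eq_card0 => i; rewrite !inE ffunE.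
move=> /andP[/andP[anc_a d1] d2].
(* Handles both children at once: [b] is the outcome of the test at [x], and [T] the child that [x]
   enters. *)
suff step b (T : dtree dim) : (dt_height T <= maxn (dt_height T1) (dt_height T2))%N ->
    (exists s : sides, [/\ forall i, i \in a :: anc -> s i = None,
      (ntests s <= dt_height T)%N &
      forall y, anchored s x y -> dt_eval T y = dt_eval T x]) ->
    (forall y : point, side (Some b) (x a) (y a) -> (t <= y a)%N = (t <= x a)%N) ->
    (if (t <= x a)%N then T1 else T2) = T ->
  exists s : sides, [/\ forall i, i \in anc -> s i = None,
    (ntests s <= (maxn (dt_height T1) (dt_height T2)).+1)%N &
    forall y, anchored s x y ->
      (if (t <= y a)%N then dt_eval T1 y else dt_eval T2 y) =
      (if (t <= x a)%N then dt_eval T1 x else dt_eval T2 x)].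
  have [tx|tx] : (t <= x a)%N \/ (x a < t)%N by apply/orP; rewrite leqNgt orNb.
    apply: (step true T1) => //; [exact: leq_maxl|exact: IH1| |by rewrite tx].
    by move=> y /= xy; rewrite tx (leq_trans tx xy).
  apply: (step false T2) => //; [exact: leq_maxr|exact: IH2| |by rewrite leqNgt tx].
  by move=> y /= yx; rewrite !(leqNgt t) tx (leq_ltn_trans yx tx).
move=> hT [s [s_anc s_n s_ev]] ab eT.
exists [ffun i => if i == a then Some b else s i]; split.
- move=> i ianc; rewrite ffunE; case: eqP => [ia|_]; first by rewrite -ia ianc in anc_a.
  by apply: s_anc; rewrite inE ianc orbT.
- apply: leq_trans (_ : (ntests s).+1 <= _)%N; last by rewrite ltnS (leq_trans s_n).
  rewrite /ntests -add1n -(card1 a) -cardUI -[leqLHS]addn0 leq_add// subset_leq_card//.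
  by apply/fintype.subsetP => i; rewrite !inE ffunE; case: eqP.
- move=> y /forallP xy; rewrite ab; last by have := xy a; rewrite ffunE eqxx.
  have {}s_ev : dt_eval T y = dt_eval T x.
    apply: s_ev; apply/forallP => i; have := xy i; rewrite ffunE.
    by case: eqP => // -> _; rewrite s_anc ?mem_head.
  by move: eT s_ev; case: ifP => _ <-.
Qed.

Lemma card_forall (Q : forall i : 'I_dim, pred 'I_w.+1) :
  #|[pred y : point | [forall i, Q i (y i)]]| = (\prod_i #|Q i|)%N.
Proof.
rewrite (eq_card (_ : _ =i family Q)).
  by rewrite card_family foldrE big_map big_enum.
by move=> y; apply/forallP/familyP.
Qed.

(** Box sizes in a product set are products, so the sum becomes a product of one-coordinate sums:
    harmonic for a constrained coordinate, at most 1 for a free one. *)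
Lemma sum_inv_card_anchored (P : 'I_dim -> {set 'I_w.+1}) (s : sides) :
  \sum_(x : point | [forall i, x i \in P i])
     (#|[pred y : point | anchored s x y & [forall i, y i \in P i]]|%:R : R)^-1
  <= harmonic_sum R w.+1 ^+ ntests s.
Proof.
(* The value 0 outside [P i] lets the sum run over all points before distributing it. *)
pose F i j : R := if j \in P i then #|[pred k in P i | side (s i) j k]|%:R^-1 else 0.
have -> : \sum_(x : point | [forall i, x i \in P i])
     (#|[pred y : point | anchored s x y & [forall i, y i \in P i]]|%:R : R)^-1
   = \sum_(x : point) \prod_i F i (x i).
  rewrite big_mkcond /=; apply: eq_bigr => x _; case: ifP => [/forallP xP|].
    rewrite (eq_card (_ : _ =i [pred y : point |
        [forall i, [pred k in P i | side (s i) (x i) k] (y i)]])).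
      rewrite (card_forall (fun i => [pred k in P i | side (s i) (x i) k])) natr_prod -prodfV; apply: eq_bigr => i _.
      by rewrite /F xP.
    move=> y; rewrite !inE; apply/andP/forallP.
      by move=> [/forallP h1 /forallP h2] i; rewrite /= h1 h2.
    by move=> h; split; apply/forallP => i; have /= /andP[] := h i.
  move=> /negbT; rewrite negb_forall => /existsP[i xi].
  by rewrite (bigD1 i)//= /F (negbTE xi) mul0r.
rewrite -bigA_distr_bigA /=.
have -> : harmonic_sum R w.+1 ^+ ntests s =
    \prod_i (if isSome (s i) then harmonic_sum R w.+1 else 1).
  by rewrite -big_mkcond /= prodr_const.
apply: ler_prod => i _; apply/andP; split.
  by apply: sumr_ge0 => j _; rewrite /F; case: ifP => // _; rewrite invr_ge0 ler0n.
rewrite /F -big_mkcond /=; case: (s i) => [b|/=]; first exact: sum_inv_card_side.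
under eq_bigr => j _.
  rewrite (eq_card (_ : _ =i P i)); last by move=> k; rewrite !inE andbT.
  over.
rewrite sumr_const.
have [->|h] := eqVneq #|P i| 0%N; first by rewrite mulr0n ler01.
by rewrite -[leLHS]mulr_natr mulVf// pnatr_eq0.
Qed.

(* The disagreement region of a ball around h only contains crowded points.
   The cell P is the part of the grid reached after some tests of the tree h,
   which makes an induction on that tree possible. *)
Definition crowded (h : point -> bool) (P : 'I_dim -> {set 'I_w.+1}) d (t : R) (x : point) :=
  [exists s : sides, (ntests s <= d)%N &&
     (#|[pred y : point | [&& anchored s x y, [forall i, y i \in P i] & h y == h x]]|%:R <= t)].

(** At a leaf the tree is constant on [P], and Markov's inequality applies to each pattern of sides.
    At a node, crowdedness passes to the half of [P] containing the point, and the two bounds add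
    up. *)
Lemma card_crowded (T : dtree dim) (P : 'I_dim -> {set 'I_w.+1}) d (t : R) : 0 <= t ->
  #|[pred x : point | [forall i, x i \in P i] & crowded (dt_eval T) P d t x]|%:R
  <= 2 ^+ dt_height T * (#|sides|%:R * t * harmonic_sum R w.+1 ^+ d).
Proof.
move=> t0; elim: T P => [b|a k T1 IH1 T2 IH2] P /=.
  rewrite expr0 mul1r.
  (* A crowded point contributes at least 1, through the pattern [s] whose box has at most [t]
     points. *)
  apply: le_trans (_ : _ <= \sum_(s : sides | (ntests s <= d)%N)
    \sum_(x : point | [forall i, x i \in P i])
     (t * (#|[pred y : point | anchored s x y & [forall i, y i \in P i]]|%:R)^-1)) _.
    rewrite exchange_big /= -sum1_card natr_sum big_mkcondr /=.
    apply: ler_sum => x xP; case: ifP => [/existsP[s /andP[sd sc]]|_]; last first.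
      by apply: sumr_ge0 => s _; rewrite mulr_ge0// invr_ge0 ler0n.
    rewrite (bigD1 s)//= ler_wpDr//.
      by apply: sumr_ge0 => ? _; rewrite mulr_ge0// invr_ge0 ler0n.
    have c0 : (0 < #|[pred y : point | anchored s x y & [forall i, y i \in P i]]|)%N.
      apply/card_gt0P; exists x; rewrite !inE xP andbT.
      by apply/forallP => i; exact: side_refl.
    rewrite ler_pdivlMr ?ltr0n// mul1r; apply: le_trans sc; rewrite ler_nat.
    by apply: subset_leq_card; apply/fintype.subsetP => y; rewrite !inE eqxx andbT.
  apply: le_trans (_ : _ <= \sum_(s : sides | (ntests s <= d)%N)
     (t * harmonic_sum R w.+1 ^+ d)) _.
    apply: ler_sum => s sd; rewrite -mulr_sumr ler_wpM2l//.
    apply: (le_trans (sum_inv_card_anchored P s)).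
    by rewrite ler_weXn2l// harmonic_sum_ge1.
  rewrite sumr_const -[leLHS]mulr_natl -mulrA ler_wpM2r ?ler_nat ?max_card//.
  by rewrite mulr_ge0// exprn_ge0// harmonic_sum_ge0.
(* [Q b] is the half of the cell [P] where the root test has outcome [b]. *)
pose Q (b : bool) i := if i == a then [set j in P i | (k <= j)%N == b]%SET else P i.
have QP b (x : point) : [forall i, x i \in Q b i] =
    [forall i, x i \in P i] && ((k <= x a)%N == b).
  apply/forallP/andP => [h|[/forallP h hb] i].
    split; last by have := h a; rewrite /Q eqxx inE => /andP[].
    by apply/forallP => i; have := h i; rewrite /Q; case: ifP => // _; rewrite inE => /andP[].
  by rewrite /Q; case: eqP => // ->; rewrite inE h.
set M := (_ * _ * _) in IH1 IH2 *.
have M0 : 0 <= M by rewrite !mulr_ge0// exprn_ge0// harmonic_sum_ge0.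
apply: le_trans (_ : _ <= 2 ^+ dt_height T1 * M + 2 ^+ dt_height T2 * M) _; last first.
  rewrite -mulrDl ler_wpM2r// exprS mulr_natl mulr2n lerD// ler_weXn2l ?leq_maxl ?leq_maxr//;
    by rewrite (ler_nat _ 1 2).
apply: le_trans (lerD (IH1 (Q true)) (IH2 (Q false))).
rewrite -natrD ler_nat -cardUI; apply: leq_trans (leq_addr _ _).
apply: subset_leq_card; apply/fintype.subsetP => x; rewrite !inE => /andP[xP].
move=> /existsP[s /andP[sd sc]]; rewrite !QP xP /=.
have sub (T : dtree dim) : (forall y : point, (k <= y a)%N = (k <= x a)%N ->
      dt_eval (DNode a k T1 T2) y = dt_eval T y) ->
    crowded (dt_eval T) (Q (k <= x a)%N) d t x.
  move=> eT; apply/existsP; exists s; rewrite sd /=; apply: le_trans sc.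
  rewrite ler_nat; apply: subset_leq_card; apply/fintype.subsetP => y; rewrite !inE QP.
  by move=> /and3P[-> /andP[-> /eqP e]] /=; rewrite -(eT y e) -(eT x erefl).
case: (boolP (k <= x a)%N) sub => kx sub /=.
  by rewrite orbF sub// => y /= ->.
by rewrite sub// => y /= ->.
Qed.

End Upper.

(** * From point counts to the suprema defining [theta] *)

Section Theta.
Variables (R : realType) (dim w d : nat).
Notation point := (gpoint dim w).
Notation sides := {ffun 'I_dim -> option bool}.

Lemma npts_gt0 : (0 < npts dim w)%N.
Proof. by apply/card_gt0P; exists [ffun=> ord0]. Qed.

Lemma nptsE : npts dim w = (w.+1 ^ dim)%N.
Proof. by rewrite /npts card_ffun !card_ord. Qed.

Lemma DSE (h h' : point -> bool) :
  DS R h h' = #|[pred x | h x != h' x]|%:R / (npts dim w)%:R.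
Proof.
rewrite /DS; congr (_%:R / _); apply: eq_card => x.
by apply/idP/idP; rewrite !inE.
Qed.

(** At most 2^d cells of [h], times 3^dim patterns of sides; independent of [h] and [r]. *)
Definition theta_bound : R := 2 ^+ d * (#|sides|%:R * harmonic_sum R w.+1 ^+ d).

Lemma card_DIS_le (h : point -> bool) (r : R) : @Hclass dim w d h -> 0 < r ->
  #|DIS (ballH d h r)|%:R / (r * (npts dim w)%:R) <= theta_bound.
Proof.
move=> [T [hT [dT hE]]] r0.
have n0 : 0 < (npts dim w)%:R :> R by rewrite ltr0n npts_gt0.
rewrite ler_pdivrMr ?mulr_gt0//.
set t := r * _; have t0 : 0 < t by rewrite mulr_gt0.
pose P (i : 'I_dim) := [set: 'I_w.+1]%SET.
have PT (x : point) : [forall i, x i \in P i] by apply/forallP => i; rewrite inE.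
have sub : (#|DIS (ballH d h r)| <= #|[pred x : point | [forall i, x i \in P i]
    & crowded (dt_eval T) P d t x]|)%N.
  apply: subset_leq_card; apply/fintype.subsetP => x; rewrite !inE PT /=.
  (* On the box around [x] where [g] is constant, every point with the same [h]-label as [x] is a
     disagreement of [g] and [h]. *)
  have far (g : point -> bool) : ballH d h r g -> g x != h x ->
      crowded (dt_eval T) P d t x.
    move=> [[T' [hT' [dT' gE]]] hg] gx.
    have [s [_ sn sE]] := dt_eval_anchored x dT'.
    apply/existsP; exists s; rewrite (leq_trans sn hT') /=.
    move: hg; rewrite DSE ler_pdivrMr// => /(le_trans _); apply; rewrite ler_nat.
    apply: subset_leq_card; apply/fintype.subsetP => y; rewrite !inE.
    by move=> /and3P[/sE e _]; rewrite -!hE => /eqP ->; rewrite gE e -gE eq_sym.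
  move=> [h1 [h2 [b1 [b2 ne]]]].
  (* Two classifiers that disagree at [x] cannot both agree with [h] there. *)
  have [/eqP e|n] := boolP (h1 x == h x); last exact: far b1 n.
  by apply: (far h2) => //; rewrite -e eq_sym.
apply: le_trans (_ : _ <= #|[pred x : point | [forall i, x i \in P i]
    & crowded (dt_eval T) P d t x]|%:R) _; first by rewrite ler_nat.
apply: (le_trans (card_crowded T P d (ltW t0))).
rewrite /theta_bound (mulrAC #|sides|%:R) [leLHS]mulrA ler_wpM2r ?(ltW t0)//.
rewrite ler_wpM2r ?mulr_ge0 ?exprn_ge0 ?harmonic_sum_ge0//.
by rewrite ler_weXn2l// (ler_nat _ 1 2).
Qed.

Lemma theta_h_le (h : point -> bool) : @Hclass dim w d h -> theta_h R d h <= theta_bound.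
Proof.
move=> hH; apply: ge_sup; first by eexists; exists 1; [exact: ltr01|reflexivity].
by move=> _ [r r0 <-]; exact: card_DIS_le.
Qed.

Lemma Hclass_cst b : @Hclass dim w d (fun=> b).
Proof. by exists (DLeaf _ b). Qed.

Lemma theta_le : theta R dim w d <= theta_bound.
Proof.
apply: ge_sup; first by eexists; exists (fun=> true); [exact: Hclass_cst|reflexivity].
by move=> _ [h hH <-]; exact: theta_h_le.
Qed.

(** A real [sup] dominates its set only if the set is bounded; [theta_bound] bounds both nested
    suprema. *)
Lemma le_theta (h : point -> bool) (r : R) : @Hclass dim w d h -> 0 < r ->
  #|DIS (ballH d h r)|%:R / (r * (npts dim w)%:R) <= theta R dim w d.
Proof.
move=> hH r0; apply: le_trans (_ : _ <= theta_h R d h) _.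
  apply: ub_le_sup; last by exists r.
  by exists theta_bound => _ [r' r'0 <-]; exact: card_DIS_le.
apply: ub_le_sup; last by exists h.
by exists theta_bound => _ [h' h'H <-]; exact: theta_h_le.
Qed.

End Theta.

(** * Sums of logarithmic powers *)

Lemma expB_le (R : realType) (a b : R) k : 0 <= b -> b <= a ->
  a ^+ k.+1 - b ^+ k.+1 <= k.+1%:R * a ^+ k * (a - b).
Proof.
move=> b0 ba; have a0 := le_trans b0 ba.
rewrite subrXX mulrC ler_wpM2r ?subr_ge0//.
apply: le_trans (_ : _ <= \sum_(i < k.+1) a ^+ k) _.
  apply: ler_sum => i _ /=; rewrite -[in leRHS](subnK (ltnSE (ltn_ord i))) exprD.
  by rewrite ler_wpM2l ?exprn_ge0// lerXn2r ?nnegrE.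
by rewrite sumr_const card_ord -[leLHS]mulr_natl.
Qed.

(* Riemann-sum form of int_1^s ln(s/t)^k dt/t = ln(s)^(k+1)/(k+1). *)
Lemma sum_ln_ge (R : realType) k m (s : R) : 1 <= s <= m%:R ->
  ln s ^+ k.+1 <=
  k.+1%:R * \sum_(j < m | j.+1%:R <= s) ln (s / j.+1%:R) ^+ k / j.+1%:R.
Proof.
move=> /andP[s1 sm]; have s0 : 0 < s by exact: lt_le_trans s1.
(* Truncation at 0 lets the powers of [a] telescope past [s]: [a 0] is [ln s], and [a m] is 0
   because [s <= m]. *)
pose a (j : nat) : R := Num.max 0 (ln (s / j.+1%:R)).
have a_small (j : nat) : s < j.+1%:R -> a j = 0.
  by move=> sj; apply/max_idPl; rewrite ln_le0// ler_pdivrMr ?ltr0n// mul1r ltW.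
have a_big (j : nat) : j.+1%:R <= s -> a j = ln (s / j.+1%:R).
  by move=> js; apply/max_idPr; rewrite ln_ge0// ler_pdivlMr ?ltr0n// mul1r.
have tele p : ln s ^+ k.+1 - a p ^+ k.+1 <=
    k.+1%:R * \sum_(j < p | j.+1%:R <= s) ln (s / j.+1%:R) ^+ k / j.+1%:R.
  elim: p => [|p IH]; first by rewrite big_ord0 mulr0 a_big ?divr1 ?subrr.
  rewrite big_mkcond big_ord_recr -big_mkcond /= mulrDr.
  suff : a p ^+ k.+1 - a p.+1 ^+ k.+1 <=
     k.+1%:R * (if p.+1%:R <= s then ln (s / p.+1%:R) ^+ k / p.+1%:R else 0).
    by move=> /(lerD IH); rewrite addrA subrK.
  case: ifPn => [ps|]; last first.
    rewrite -ltNge => sp; rewrite !a_small ?expr0n ?subr0 ?mulr0//.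
    by apply: lt_trans sp _; rewrite ltr_nat.
  have p0 : 0 < p.+1%:R :> R by rewrite ltr0n.
  have q0 : 0 < p.+2%:R :> R by rewrite ltr0n.
  have b0 : 0 <= a p.+1 by rewrite le_max lexx.
  have db : a p - a p.+1 <= p.+1%:R^-1.
    have h1 : ln (s / p.+2%:R) <= a p.+1 by rewrite le_max lexx orbT.
    have e : (p.+2%:R - p.+1%:R) / p.+1%:R = p.+1%:R^-1 :> R.
      by rewrite -[p.+2%:R]natr1 addrAC subrr add0r mul1r.
    have := lnB_le p0 q0; rewrite e => h2.
    rewrite a_big// lerBlDr; apply: (le_trans _ (lerD h2 h1)).
    by rewrite !ln_div ?posrE// [leRHS]addrC addrA subrK.
  have ba : a p.+1 <= a p.
    rewrite (a_big _ ps) ge_max ln_ge0 ?ler_pdivlMr ?mul1r//=.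
    rewrite ler_ln ?posrE ?divr_gt0// ler_wpM2l ?(ltW s0)//.
    by rewrite lef_pV2 ?posrE// ler_nat.
  apply: (le_trans (expB_le k b0 ba)).
  rewrite -mulrA ler_wpM2l// -a_big// ler_wpM2l// exprn_ge0// (le_trans b0 ba)//.
have := tele m; rewrite a_small ?expr0n ?subr0//.
by apply: le_lt_trans sm _; rewrite ltr_nat.
Qed.

(** The count is at least [s - 1] and at least 1, hence at least their average. *)
Lemma count_le_ge (R : realType) m (s : R) : 1 <= s <= m%:R ->
  s / 2 <= \sum_(j < m | j.+1%:R <= s) 1.
Proof.
move=> /andP[s1 sm].
have h p : s <= p.+1%:R -> s - 1 <= \sum_(j < p | j.+1%:R <= s) 1.
  elim: p => [|p IH] sp; first by rewrite big_ord0 subr_le0.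
  have [sp1|sp1] := leP s p.+1%:R.
    apply: (le_trans (IH sp1)); rewrite [leRHS]big_mkcond big_ord_recr -big_mkcond /=.
    by rewrite lerDl; case: ifP.
  rewrite (eq_bigl predT) ?sumr_const ?card_ord ?lerBlDr ?natr1//.
  by move=> j /=; apply: le_trans (ltW sp1); rewrite ler_nat ltn_ord.
have h1 : 1 <= \sum_(j < m | j.+1%:R <= s) (1 : R).
  case: m sm h => [|m] sm h; first by have := le_trans s1 sm; rewrite ler10.
  by rewrite (bigD1 ord0)//= lerDl sumr_ge0.
have := h m (le_trans sm _); rewrite ler_nat leqnSn => /(_ isT) h2.
lra.
Qed.

(** * Counting points under a hyperboloid *)

Section Lower.
Variables (R : realType) (dim w : nat).
Notation point := (gpoint dim w).

Definition upd (x : point) (i : 'I_dim) (j : 'I_w.+1) : point :=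
  [ffun k => if k == i then j else x k].

(** Coordinate [i] is independent of [P]: [upd] injects each slice of [P] into every other, so all
    slices have equal size. *)
Lemma card_slice (i : 'I_dim) (A : pred 'I_w.+1) (P : pred point) :
  (forall x j, P (upd x i j) = P x) ->
  (w.+1 * #|[pred x : point | A (x i) & P x]| = #|A| * #|P|)%N.
Proof.
move=> Pu; pose f j := #|[pred x : point | x i == j & P x]|.
have fle j j' : (f j <= f j')%N.
  rewrite /f -(@card_in_imset _ _ (fun x => upd x i j') [pred x : point | x i == j & P x]).
    apply: subset_leq_card; apply/fintype.subsetP => _ /imsetP[x xP ->].
    by move: xP; rewrite !inE ffunE eqxx eqxx Pu => /andP[].
  move=> x y; rewrite !inE => /andP[/eqP xi _] /andP[/eqP yi _] /ffunP e.
  apply/ffunP => k; have := e k; rewrite !ffunE; case: eqP => // ->.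
  by rewrite xi yi.
have fE j : f j = f ord0 by apply/eqP; rewrite eqn_leq !fle.
have cA (B : pred 'I_w.+1) : #|[pred x : point | B (x i) & P x]| = (#|B| * f ord0)%N.
  rewrite -sum1_card (partition_big (fun x : point => x i) B) /=; last by move=> x /andP[].
  rewrite -sum_nat_const; apply: eq_bigr => j Bj; rewrite -(fE j) /f -sum1_card.
  apply: eq_bigl => x; rewrite !inE; case: eqP => [->|_]; last by rewrite andbF.
  by rewrite Bj andbT.
have -> : #|P| = (w.+1 * f ord0)%N.
  by rewrite -[w.+1 in RHS]card_ord -(cA predT); apply: eq_card.
by rewrite cA mulnCA.
Qed.

(** The factor [(x i).+1] counts the values up to [x i], so the product measures the corner box
    below [x]. *)
Definition hyper (l : seq 'I_dim) (s : R) (x : point) : bool :=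
  \prod_(i <- l) (x i).+1%:R <= s.

Lemma hyper_upd l s x i j : i \notin l -> hyper l s (upd x i j) = hyper l s x.
Proof.
move=> il; rewrite /hyper /=; congr (_ <= s).
rewrite big_seq [RHS]big_seq; apply: eq_bigr => k kl; rewrite ffunE.
by case: eqP kl => // ->; rewrite (negbTE il).
Qed.

Lemma hyper_cons i l s x : hyper (i :: l) s x = hyper l (s / (x i).+1%:R) x.
Proof. by rewrite /hyper /= big_cons mulrC ler_pdivlMr ?ltr0n. Qed.

Lemma card_hyper_cons i l s : i \notin l ->
  (w.+1 * #|hyper (i :: l) s| = \sum_(j < w.+1) #|hyper l (s / j.+1%:R)|)%N.
Proof.
move=> il; rewrite -[#|hyper (i :: l) s|]sum1_card.
rewrite (partition_big (fun x : point => x i) xpredT) //= big_distrr /=.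
apply: eq_bigr => j _; rewrite -[RHS]mul1n -[X in _ = (X * _)%N](card1 j).
rewrite -(card_slice (i := i)); last by move=> x k; exact: hyper_upd.
congr (_ * _)%N; rewrite -sum1_card; apply: eq_bigl => x.
rewrite !inE unfold_in andbC; case: eqP => //= xi.
by rewrite -xi -hyper_cons.
Qed.

(** Slicing along [i] replaces [s] by s/(j+1). Slices with j+1 > s are dropped, and [sum_ln_ge] sums
    the others, raising the power of the logarithm and extending the factorial. [count_le_ge] starts
    the induction and gives the factor 1/2. *)
Lemma card_hyper_ge i l (s : R) : uniq (i :: l) -> 1 <= s <= w.+1%:R ->
  (npts dim w)%:R * (s / 2 * ln s ^+ size l / (size l)`!%:R)
  <= w.+1%:R ^+ (size l).+1 * #|hyper (i :: l) s|%:R.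
Proof.
elim: l i s => [|a l IH] i s.
  move=> _ s1; rewrite expr0 fact0 divr1 mulr1 expr1 -natrM card_hyper_cons//.
  apply: le_trans (ler_wpM2l (ler0n _ _) (count_le_ge s1)) _.
  rewrite natr_sum big_mkcond mulr_sumr; apply: ler_sum => j _.
  case: ifP => [js|_]; last by rewrite mulr0.
  rewrite mulr1 ler_nat; apply: subset_leq_card; apply/fintype.subsetP => x _.
  by rewrite unfold_in /hyper big_nil ler_pdivlMr ?ltr0n// mul1r.
move=> /[dup] /andP[ial _]; rewrite cons_uniq => /andP[_ ul] /[dup] ss /andP[s1 sm].
have s0 : 0 < s by exact: lt_le_trans s1.
rewrite [w.+1%:R ^+ _]exprSr -[leRHS]mulrA -natrM card_hyper_cons// natr_sum mulr_sumr.
pose c : R := (npts dim w)%:R * (s / 2) / (size l)`!%:R.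
have c0 : 0 <= c by rewrite /c !mulr_ge0 ?invr_ge0 ?ler0n// ltW.
apply: le_trans (_ : _ <= \sum_(j < w.+1 | j.+1%:R <= s)
    c * (ln (s / j.+1%:R) ^+ size l / j.+1%:R)) _.
  rewrite -mulr_sumr /=.
  apply: le_trans (_ : _ <= c / (size l).+1%:R * ln s ^+ (size l).+1) _.
    rewrite /c factS natrM invfM le_eqVlt; apply/orP; left; apply/eqP => /=; ring.
  rewrite -mulrA ler_wpM2l// ler_pdivrMl ?ltr0n//.
  exact: sum_ln_ge.
rewrite big_mkcond; apply: ler_sum => j _; case: ifP => [js|_]; last first.
  by rewrite mulr_ge0 ?exprn_ge0.
apply: le_trans (IH a (s / j.+1%:R) ul _).
  by rewrite le_eqVlt; apply/orP; left; apply/eqP; rewrite /c; ring.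
rewrite ler_pdivlMr ?ltr0n// mul1r js /=.
by rewrite ler_pdivrMr ?ltr0n// (le_trans sm)// ler_peMr// ler1n.
Qed.

(** * Corner boxes as trees, and the lower bound on [theta] *)

Fixpoint corner_tree (x : point) (l : seq 'I_dim) : dtree dim :=
  if l is a :: l' then DNode a (x a).+1 (DLeaf _ false) (corner_tree x l')
  else DLeaf _ true.

(** The threshold [(x a).+1] sends exactly the points with [y a > x a] to the leaf [false]. *)
Lemma corner_tree_eval (x : point) l (y : point) :
  dt_eval (corner_tree x l) y = all (fun a => y a <= x a)%N l.
Proof. by elim: l => //= a l ->; rewrite ltnNge; case: (y a <= x a)%N. Qed.

Lemma corner_tree_height x l : dt_height (corner_tree x l) = size l.
Proof. by elim: l => //= a l ->; rewrite max0n. Qed.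

Lemma corner_tree_distinct x l anc : uniq l -> ~~ has (mem anc) l ->
  dt_distinct anc (corner_tree x l).
Proof.
elim: l anc => //= a l IH anc /andP[al ul]; rewrite negb_or => /andP[aanc hl].
rewrite aanc /=; apply: IH => //; apply/hasPn => k kl /=; rewrite inE negb_or.
by rewrite (hasPn hl) // andbT; apply: contraNneq al => <-.
Qed.

Lemma card_corner (x : point) l : uniq l ->
  (w.+1 ^ size l * #|[pred y : point | all (fun a => y a <= x a)%N l]| =
   npts dim w * \prod_(a <- l) (x a).+1)%N.
Proof.
elim: l => [|a l IH] /=.
  by move=> _; rewrite big_nil muln1 expn0 mul1n; apply: eq_card.
move=> /andP[al ul].
have -> : #|[pred y : point | (y a <= x a)%N && all (fun b => y b <= x b)%N l]| =
   #|[pred y : point | [pred k : 'I_w.+1 | (k <= x a)%N] (y a) &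
      [pred y : point | all (fun b => y b <= x b)%N l] y]| by [].
rewrite expnSr -mulnA card_slice; last first.
  move=> y j /=; apply: eq_in_all => b bl; rewrite ffunE.
  by case: eqP bl => // ->; rewrite (negbTE al).
rewrite mulnCA IH// big_cons mulnCA; congr (_ * _)%N; congr (_ * _)%N.
rewrite -sum1_card (eq_bigl (fun k : 'I_w.+1 => (k < (x a).+1)%N)) //.
by rewrite -(big_ord_widen w.+1 (fun=> 1%N) (ltn_ord (x a))) sum_nat_const card_ord muln1.
Qed.

Lemma theta_ge d : (0 < d <= dim)%N ->
  ln w.+1%:R ^+ d.-1 / 2 / (d.-1)`!%:R <= theta R dim w d.
Proof.
move=> /andP[d0 dd].
have m0 : 0 < w.+1%:R :> R by rewrite ltr0n.
have n0 : 0 < (npts dim w)%:R :> R by rewrite ltr0n npts_gt0.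
(* A corner box over [d] coordinates is the fraction of the grid given by its product over (w+1)^d;
   this radius admits every product up to w+1. *)
pose r : R := w.+1%:R / w.+1%:R ^+ d.
have r0 : 0 < r by rewrite divr_gt0 ?exprn_gt0.
apply: le_trans (le_theta (Hclass_cst dim w d false) r0).
rewrite ler_pdivlMr ?mulr_gt0//.
have [i [l [ul sl]]] : exists i l, uniq (i :: l : seq 'I_dim) /\ size (i :: l) = d.
  have st : size (take d (enum 'I_dim)) = d.
    by rewrite size_take size_enum_ord; case: ltngtP dd.
  have := take_uniq d (enum_uniq 'I_dim).
  case: (take d _) st => [e|i l e u]; first by rewrite -e in d0.
  by exists i, l.
have sub : (#|hyper (i :: l) w.+1%:R| <= #|DIS (ballH d (fun=> false) r : set (point -> bool))|)%N.
  apply: subset_leq_card; apply/fintype.subsetP => x hx; rewrite inE.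
  apply/asboolP; exists (fun=> false), (dt_eval (corner_tree x (i :: l))).
  split; [|split]; last first.
  - rewrite corner_tree_eval; suff -> : all (fun a => x a <= x a)%N (i :: l) by [].
    exact/allP.
  - split.
      exists (corner_tree x (i :: l)); rewrite corner_tree_height sl; split=> //.
      by split=> //; apply: corner_tree_distinct => //; rewrite has_pred0.
    rewrite DSE /r ler_pdivrMr// mulrAC ler_pdivlMr ?exprn_gt0//.
    rewrite (eq_card (_ : _ =i [pred y : point | all (fun a => y a <= x a)%N (i :: l)])).
      rewrite mulrC -natrX -natrM -sl card_corner// natrM mulrC ler_wpM2r ?ler0n//.
      by move: hx; rewrite unfold_in /hyper natr_prod.
    by move=> y; rewrite !inE corner_tree_eval; case: all.
  - split; first exact: Hclass_cst.
    rewrite DSE eq_card0 ?mul0r ?(ltW r0)// => y; by rewrite !inE.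
have := card_hyper_ge ul (s := w.+1%:R); rewrite lexx ler1n -[size l]/(size (i :: l)).-1.
rewrite prednK ?sl // => /(_ isT) hc.
apply: le_trans (_ : _ <= #|hyper (i :: l) w.+1%:R|%:R) _; last by rewrite ler_nat.
rewrite -ler_pdivrMl ?exprn_gt0// in hc.
apply: le_trans hc; rewrite /r le_eqVlt; apply/orP; left; apply/eqP; ring.
Qed.

End Lower.

(** * Binomial estimates for the constant, and the asymptotic statement *)

Lemma expn_le_binM n d : (d <= n -> n ^ d <= 'C(n, d) * d ^ d)%N.
Proof.
elim: d n => [|d IH] [|n] //; rewrite ltnS => dn.
(* The absorption identity leaves (n+1)^d <= 'C(n, d) (d+1)^d, which follows from the induction
   hypothesis and d(n+1) <= n(d+1). *)
rewrite !(expnS _ d) mulnA [('C(_, _) * _)%N]mulnC -mul_bin_diag -mulnA leq_mul2l /=.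
have [->|d0] := posnP d; first by rewrite bin0.
rewrite -(@leq_pmul2l (d ^ d)) ?expn_gt0 ?d0// -expnMn.
apply: leq_trans (_ : (n * d.+1) ^ d <= _)%N.
  by rewrite leq_exp2r// mulnS [(n * _)%N]mulnS [(d * n)%N]mulnC leq_add2r.
by rewrite expnMn mulnA leq_mul2r [(d ^ d * _)%N]mulnC IH ?orbT.
Qed.

(** Chain: n^(d-1) d <= n^d <= 'C(n, d) d^d <= 2^n d^d. *)
Lemma expn_pred_le_exp2 n d : (0 < d <= n -> n ^ d.-1 <= 2 ^ n * d ^ d.-1)%N.
Proof.
case: d => // d dn /=; rewrite -(@leq_pmul2r d.+1)//.
apply: (@leq_trans (n ^ d.+1)); first by rewrite expnSr leq_mul2l (andP dn).2 orbT.
apply: (leq_trans (expn_le_binM (andP dn).2)); rewrite -mulnA -expnSr leq_mul2r.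
apply/orP; right; rewrite -[2%N]/(1 + 1)%N expnDn (bigD1 (inord d.+1))//=.
by rewrite !exp1n !muln1 inordK// leq_addr.
Qed.

Theorem theorem1 (R : realType) :
  (* theta = O(ln^d n) as n -> oo (i.e. w -> oo), for fixed dim, d *)
  (forall dim d : nat, (0 < dim)%N -> (0 < d)%N ->
     exists C : R, exists N : nat, forall w : nat, (0 < w)%N -> (N <= w)%N ->
       theta R dim w d <= C * (ln ((npts dim w)%:R : R)) ^+ d)
  /\
  (* theta = Omega(c (ln n - c')^(d-1)), c = 2^-dim / (d^(d-1) d!),
     c' = ln 4 * dim *)
  (exists K : R, 0 < K /\
     forall dim d : nat, (0 < dim)%N -> (0 < d)%N -> (d <= dim)%N ->
     exists N : nat, forall w : nat, (0 < w)%N -> (N <= w)%N ->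
       K * (((2%:R : R) ^- dim) / (((d%:R : R) ^+ (d.-1)) * ((d`!)%:R)))
         * (ln ((npts dim w)%:R : R) - ln (4%:R : R) * dim%:R) ^+ (d.-1)
       <= theta R dim w d).
Proof.
split.
  move=> dim d dim0 d0.
  (* The last [2 ^+ d] comes from 1 + ln(w+1) <= 2 ln n, valid once w+1 >= e, which the next witness
     ensures. *)
  exists (2 ^+ d * #|{ffun 'I_dim -> option bool}|%:R * 2 ^+ d).
  exists (Num.truncn (expR 1 : R)) => w _ wN.
  apply: (le_trans (theta_le R dim w d)).
  rewrite /theta_bound -!mulrA ler_wpM2l ?exprn_ge0// ler_wpM2l ?ler0n// -exprMn.
  have ln1 : 1 <= ln (w.+1%:R : R).
    rewrite -[leLHS]expRK ler_ln ?posrE ?expR_gt0 ?ltr0n//.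
    by apply: le_trans (ltW (truncnS_gt _)) _; rewrite ler_nat.
  rewrite lerXn2r ?nnegrE ?harmonic_sum_ge0//.
    by rewrite mulr_ge0// ln_ge0// ler1n npts_gt0.
  apply: (le_trans (harmonic_sum_le_ln R w)).
  have : ln (w.+1%:R : R) <= ln (npts dim w)%:R.
    rewrite ler_ln ?posrE ?ltr0n ?npts_gt0// ler_nat nptsE.
    by rewrite -[leqLHS]expn1 leq_pexp2l.
  lra.
(* The 1/2 is that of [theta_ge]; the threshold 3 below makes ln(w+1) - ln 4 nonnegative. *)
exists 2^-1; split; first by rewrite invr_gt0.
move=> dim d dim0 d0 dd; exists 3%N => w _ w3.
have w4 : (4 : R) <= w.+1%:R by rewrite (ler_nat _ 4).
apply: le_trans (theta_ge R w (d := d) _); last by rewrite d0.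
(* Since n = (w+1)^dim, the base ln n - c' equals dim (ln(w+1) - ln 4); [hd] then absorbs dim^(d-1)
   into 2^dim d^(d-1). *)
rewrite nptsE natrX lnXn ?ltr0n// -[ln _ *+ dim]mulr_natr -mulrBl.
set L := ln w.+1%:R; have L0 : 0 <= L - ln 4%:R.
  by rewrite subr_ge0 ler_ln ?posrE ?ltr0n.
have L4 : L - ln 4%:R <= L by rewrite gerDl oppr_le0 ln_ge0// (ler_nat _ 1 4).
have dp0 : 0 < d%:R ^+ d.-1 :> R by rewrite exprn_gt0 ?ltr0n.
have hd : (dim%:R ^+ d.-1 : R) <= 2 ^+ dim * d%:R ^+ d.-1.
  by rewrite -!natrX -natrM ler_nat expn_pred_le_exp2 ?d0.
rewrite exprMn.
apply: le_trans (_ : _ <= 2^-1 * ((L - ln 4%:R) ^+ d.-1 / (d`!)%:R)) _.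
  rewrite -mulrA ler_wpM2l ?invr_ge0//.
  rewrite [X in X <= _](_ : _ = (L - ln 4%:R) ^+ d.-1 / (d`!)%:R *
     (dim%:R ^+ d.-1 / (2 ^+ dim * d%:R ^+ d.-1))); last by rewrite !invfM; ring.
  rewrite ler_piMr ?divr_ge0 ?exprn_ge0 ?ler0n//.
  by rewrite ler_pdivrMr ?mul1r// mulr_gt0// exprn_gt0.
rewrite mulrC [leRHS]mulrAC ler_wpM2r ?invr_ge0// ler_pM ?exprn_ge0 ?invr_ge0 ?ler0n//.
  by rewrite lerXn2r ?nnegrE// (le_trans L0 L4).
rewrite lef_pV2 ?posrE ?ltr0n ?fact_gt0// ler_nat.
by rewrite -(prednK d0) factS /= leq_pmull.
Qed.
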